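(* Let $\{y^k\}$, $\{\bar y^{k+1}\}$ be generated by the safeguarded projected-gradient algorithm described in the context, from $y^0\in\mathcal C$, with trigger parameters $q\ge1$ and $\tau\ge0$. Suppose that: - there are constants $\underline\alpha,\overline\alpha$ with $0<\underline\alpha\le\alpha_k\le\overline\alpha<1/L$ for all $k$; - $\mathcal S\ne\varnothing$; - the level set $\mathcal L_0:=\{y\in\mathcal C:\Phi(y)\le\Phi(y^0)\}$ is bounded; - $\bigcup_{\alpha>0}\{y\in\mathcal C: y\in\Pi_{\mathcal C}(y-\alpha\nabla\Phi(y))\}\subseteq\mathcal S$; - $\alpha_k\in\mathcal A$ for all $k$, where $\mathcal A\subseteq[\underline\alpha,\overline\alpha]$ is finite and nonempty. Let $\kappa_r>0$ satisfy $\operatorname{dist}(y,\mathcal S)\le\kappa_r\|Hy-c\|$ for all $y\in\mathcal L_0$. Let $\kappa_G>0$ satisfy $\operatorname{dist}(y,\mathcal S)\le\kappa_G\,g_\alpha(y)$ for all $y\in\mathcal L_0$, $\alpha\in\mathcal A$, with $\kappa_G$ enlarged, if necessary, so that $\eta:=2c_d\underline\alpha^2/(L\kappa_G^2)\in(0,1)$, and put $\theta:=1-\eta\in(0,1)$ and $C_0:=\kappa_r\sqrt{2\Phi(y^0)}$. If $\gamma_{\mathcal S}<+\infty$, let $K_{\rm id}$ be the smallest nonnegative integer satisfying $C_0\theta^{K_{\rm id}/2}<\gamma_{\mathcal S}$; otherwise set $K_{\rm id}=0$. Assume moreover that an invoked refinement returns a solution whenever the selected face intersects $\mathcal S$: for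 every $k\ge0$, if $\mathcal T_k$ holds and $F(\bar y^{k+1})\in\mathfrak F_{\mathcal S}$, then $\widehat y^{k+1}$ is well-defined and $\widehat y^{k+1}\in\mathcal S$. (i) Suppose that the residual trigger is used with $\tau>0$. Let $K_\tau$ be the smallest nonnegative integer satisfying $$\frac{\sqrt{2\Phi(y^0)}}{s_c}\,\theta^{K_\tau/2}\le\tau .$$ Then the algorithm reaches $\mathcal S$ (i.e. $y^k\in\mathcal S$ for some $k$) no later than iteration $$K^{(\rho)}:=\max\{K_{\rm id},K_\tau\}+1,$$ and $$K_\tau\le\left\lceil\frac{2\log\left(\max\left\{1,\sqrt{2\Phi(y^0)}/(s_c\tau)\right\}\right)}{\log(1/\theta)}\right\rceil.$$ (ii) If $\mathfrak F_{\mathcal S}$ is a singleton, then the algorithm reaches $\mathcal S$ no later than iteration $$K^{(\rm stab)}:=K_{\rm id}+q.$$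
   Context: Norms are Euclidean (vectors) and spectral (matrices); inequalities are componentwise and $\odot$ is the componentwise product. Let $P,Q\in\mathbb R^{m\times n}$, $c\in\mathbb R^m$, and $\mathcal C:=\{(u,v)\in\mathbb R^n\times\mathbb R^n: u\ge0,\ v\ge0,\ u\odot v=0\}$. For $y=(u,v)\in\mathbb R^{2n}$ set $H:=[P,\ Q]$, $\Phi(y):=\tfrac12\|Hy-c\|^2=\tfrac12\|Pu+Qv-c\|^2$, so $\nabla\Phi(y)=H^\top(Hy-c)$, and $L:=\|H\|^2$ (with $L>0$). Let $\mathcal S:=\{y\in\mathcal C: Hy=c\}$. For a nonempty closed set $\Omega$, $\Pi_\Omega(y):=\operatorname{argmin}_{z\in\Omega}\|y-z\|$ (possibly set-valued), $\operatorname{dist}(y,\Omega):=\inf_{z\in\Omega}\|y-z\|$, and $\operatorname{dist}(\Omega_1,\Omega_2):=\inf\{\|z_1-z_2\|:z_1\in\Omega_1,z_2\in\Omega_2\}$. For $\alpha>0$ and $y\in\mathcal C$, $\mathcal G_\alpha(y):=\{\alpha^{-1}(y-\widehat y):\widehat y\in\Pi_{\mathcal C}(y-\alpha\nabla\Phi(y))\}$ and $g_\alpha(y):=\operatorname{dist}(0,\mathcal G_\alpha(y))$. The descent constant is $c_d:=\frac1{2\overline\alpha}-\frac L2>0$. (Constants $\kappa_r$ and $\kappa_G$ with the required properties exist under the stated hypotheses.) Faces. For $s\in\{-1,1\}^n$, $F_s:=\{(\widetilde u,\widetilde v)\in\mathcal C:\widetilde v_i=0\text{ if }s_i=1,\ \widetilde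 u_i=0\text{ if }s_i=-1\}$, and $\mathfrak F:=\{F_s:s\in\{-1,1\}^n\}$. For $y=(u,v)\in\mathcal C$, $\vartheta_i(y):=\operatorname{sgn}(u_i-v_i)\in\{-1,0,1\}$; $\chi_i(y):=1$ if $u_i>0$ or $u_i=v_i=0$, and $\chi_i(y):=-1$ if $v_i>0$; and $F(y):=F_{\chi(y)}$. Define $\mathfrak F_{\mathcal S}:=\{F\in\mathfrak F:F\cap\mathcal S\ne\varnothing\}$ and $\gamma_{\mathcal S}:=\min_{F\in\mathfrak F\setminus\mathfrak F_{\mathcal S}}\operatorname{dist}(F,\mathcal S)$ if $\mathfrak F\setminus\mathfrak F_{\mathcal S}\ne\varnothing$, and $\gamma_{\mathcal S}:=+\infty$ if $\mathfrak F_{\mathcal S}=\mathfrak F$. (Under the stated hypotheses $\mathcal S$ is compact and $\gamma_{\mathcal S}>0$.) Safeguarded projected-gradient algorithm. Given $y^0\in\mathcal C$, an integer $q\ge1$, $\tau\ge0$, set $\nu_0=0$ and $s_c:=\max\{1,\|c\|\}$. At iteration $k=0,1,2,\dots$: choose a stepsize $\alpha_k>0$; choose $\bar y^{k+1}\in\Pi_{\mathcal C}(y^k-\alpha_k\nabla\Phi(y^k))$; set $\nu_{k+1}:=\nu_k+1$ if $\vartheta(\bar y^{k+1})=\vartheta(y^k)$ and $\nu_{k+1}:=0$ otherwise. The trigger $\mathcal T_k$ holds if and only if $\|H\bar y^{k+1}-c\|/s_c\le\tau$ (the residual trigger) or $\nu_{k+1}\ge q$ (the activity-vector stability trigger). If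 $\mathcal T_k$ holds, a refinement candidate $\widehat y^{k+1}$ is computed by some rule (left open; the rule may fail to produce a candidate). If a candidate is produced and $\widehat y^{k+1}\in\mathcal C$ and $\Phi(\widehat y^{k+1})\le\Phi(\bar y^{k+1})$, set $y^{k+1}:=\widehat y^{k+1}$; in all other cases set $y^{k+1}:=\bar y^{k+1}$. *)

(* Defs.v *)
From HB Require Import structures.
From mathcomp Require Import all_boot all_order all_algebra.
From mathcomp Require Import all_classical all_reals all_analysis.

Set Implicit Arguments.
Unset Strict Implicit.
Unset Printing Implicit Defensive.

Import Order.TTheory GRing.Theory Num.Theory.

Local Open Scope classical_set_scope.
Local Open Scope ring_scope.

(* The norm `|x| that MathComp-Analysis puts on matrices is the sup norm,
   hence the explicit Euclidean and spectral norms. *)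
Definition l2norm (R : realType) d (x : 'cV[R]_d) : R :=
  Num.sqrt (\sum_(i < d) x i 0 ^+ 2).

Definition specnorm (R : realType) p d (A : 'M[R]_(p, d)) : R :=
  sup [set l2norm (A *m x) | x in [set x : 'cV[R]_d | l2norm x <= 1]].

Section Distances.
Variables (R : realType) (d : nat).
Implicit Types (x : 'cV[R]_d) (A B : set 'cV[R]_d).

(* dist and set_dist are meaningful for nonempty sets ([inf set0 = 0]). *)
Definition dist x A : R := inf [set l2norm (x - z) | z in A].

Definition set_dist A B : R :=
  inf [set r | exists z1 z2, [/\ A z1, B z2 & r = l2norm (z1 - z2)]].

Definition proj_set A x : set 'cV[R]_d :=
  [set z | A z /\ forall w, A w -> l2norm (x - z) <= l2norm (x - w)].

End Distances.

Definition is_least (A : set nat) (k : nat) : Prop :=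
  A k /\ forall j, A j -> (k <= j)%N.

(* A point y = (u, v) of R^n x R^n is the stacked column col_mx u v. *)
Definition upart (R : realType) n (y : 'cV[R]_(n + n)) (i : 'I_n) : R :=
  usubmx y i 0.

Definition vpart (R : realType) n (y : 'cV[R]_(n + n)) (i : 'I_n) : R :=
  dsubmx y i 0.

Section Complementarity.
Variables (R : realType) (n : nat).
Implicit Types (y : 'cV[R]_(n + n)) (s : {ffun 'I_n -> int}).

Definition compl_set : set 'cV[R]_(n + n) :=
  [set y | forall i, [/\ 0 <= upart y i, 0 <= vpart y i &
                         upart y i * vpart y i = 0]].

Definition face s : set 'cV[R]_(n + n) :=
  [set y | compl_set y /\
     forall i, (s i = 1 -> vpart y i = 0) /\ (s i = -1 -> upart y i = 0)].

Definition faces : set (set 'cV[R]_(n + n)) :=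
  [set face s | s in [set s : {ffun 'I_n -> int} |
                     forall i, s i = 1 \/ s i = -1]].

Definition activity y : {ffun 'I_n -> int} :=
  [ffun i => sgz (upart y i - vpart y i)].

(* On compl_set the second branch is exactly the case 0 < vpart y i. *)
Definition face_sign y : {ffun 'I_n -> int} :=
  [ffun i => if (0 < upart y i) || ((upart y i == 0) && (vpart y i == 0))
             then 1 else -1].

Definition face_of y : set 'cV[R]_(n + n) := face (face_sign y).

End Complementarity.

Section Problem.
Variables (R : realType) (m n : nat).
Variables (P Q : 'M[R]_(m, n)) (c : 'cV[R]_m).
Implicit Types y : 'cV[R]_(n + n).

Definition Hmx : 'M[R]_(m, n + n) := row_mx P Q.

Definition resid y : R := l2norm (Hmx *m y - c).

Definition Phi y : R := 2^-1 * resid y ^+ 2.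

Definition gradPhi y : 'cV[R]_(n + n) := Hmx^T *m (Hmx *m y - c).

Definition Lconst : R := specnorm Hmx ^+ 2.

Definition sols : set 'cV[R]_(n + n) :=
  [set y | compl_set y /\ Hmx *m y = c].

Definition level_set (y0 : 'cV[R]_(n + n)) : set 'cV[R]_(n + n) :=
  [set y | compl_set y /\ Phi y <= Phi y0].

Definition pg_proj (a : R) y : set 'cV[R]_(n + n) :=
  proj_set (@compl_set R n) (y - a *: gradPhi y).

Definition pg_map (a : R) y : set 'cV[R]_(n + n) :=
  [set a^-1 *: (y - z) | z in pg_proj a y].

Definition pg_resid (a : R) y : R := dist 0 (pg_map a y).

Definition sol_faces : set (set 'cV[R]_(n + n)) :=
  [set F | faces F /\ F `&` sols !=set0].

(* An infimum over finitely many faces, hence a minimum when some face misses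
   sols, and +oo when there is none. *)
Definition gammaS : \bar R :=
  ereal_inf [set (set_dist F sols)%:E | F in @faces R n `\` sol_faces].

Definition res_scale : R := Num.max 1 (l2norm c).

(* y k, ybar k.+1, alpha k, nu k are the iterates, projected-gradient points,
   stepsizes and stability counters; ybar 0 and yhat 0 are unused.  yhat k.+1
   is the refinement candidate of iteration k, None when the rule produces
   none; it is only looked at when the trigger holds. *)
Definition trigger (q : nat) (tau : R) (ybar : nat -> 'cV[R]_(n + n))
    (nu : nat -> nat) (k : nat) : Prop :=
  resid (ybar k.+1) / res_scale <= tau \/ (q <= nu k.+1)%N.

Record safeguarded_pg (q : nat) (tau : R) (alpha : nat -> R)
    (y ybar : nat -> 'cV[R]_(n + n)) (yhat : nat -> option 'cV[R]_(n + n))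
    (nu : nat -> nat) : Prop := SafeguardedPG {
  spg_init : compl_set (y 0%N);
  spg_nu0 : nu 0%N = 0%N;
  spg_step : forall k, 0 < alpha k;
  spg_proj : forall k, pg_proj (alpha k) (y k) (ybar k.+1);
  spg_nu : forall k, nu k.+1 =
    if activity (ybar k.+1) == activity (y k) then (nu k).+1 else 0%N;
  spg_next : forall k, y k.+1 =
    if yhat k.+1 is Some z then
      if `[< [/\ trigger q tau ybar nu k, compl_set z &
                 Phi z <= Phi (ybar k.+1)] >]
      then z else ybar k.+1
    else ybar k.+1
}.

End Problem.

(* Main.v *)
Require Import Defs.
From HB Require Import structures.
From mathcomp Require Import all_boot all_order all_algebra.
From mathcomp Require Import all_classical all_reals all_analysis.
From mathcomp Require Import ring lra.

(** The proof combines a linear rate for the objective with a finite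
    identification of the right face.

    Rate.  A projected-gradient step decreases [Phi] by at least [cd] times the
    squared step length ([pg_descent]); the competitor in the projection is the
    current point itself, so nonconvexity of the complementarity set does no
    harm.  The error bound says that a short step means a small distance to the
    solution set, and [Phi] is at most [L / 2] times the square of that
    distance.  Together, every step multiplies [Phi] by at most [theta]
    ([pg_contraction]); the safeguard keeps this for refined iterates, so the
    residual after [k] steps is at most [theta ^ (k / 2)] times the initial one
    ([spg_decay], [resid_decay]).

    Identification.  By the residual error bound, from index [Kid] on the
    iterates and the projected points are closer to the solution set than any
    face that misses it, so every face through such a point meets the solution
    set ([sol_faces_near]) and a triggered refinement lands on a solution.

    It remains to see that a trigger fires.  The residual trigger does so as
    soon as the geometric bound is below [tau]; the logarithmic estimate of the
    number of steps is [least_geometric_le].  If only one face meets the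
    solution set, no point close to that set can have a degenerate coordinate,
    since it would lie on two faces; hence the activity vector is constant from
    index [Kid] on ([activity_near]) and the stability counter reaches [q]
    within [q] further iterations. *)

Set Implicit Arguments.
Unset Strict Implicit.
Unset Printing Implicit Defensive.

Import Order.TTheory GRing.Theory Num.Theory.

Local Open Scope classical_set_scope.
Local Open Scope ring_scope.

(** * Euclidean and spectral norms *)

Section EuclideanNorm.
Variables (R : realType) (d : nat).
Implicit Types x z : 'cV[R]_d.

Definition dotv x z : R := (x^T *m z) 0 0.

Lemma dotvC x z : dotv x z = dotv z x.
Proof. by rewrite /dotv -[in RHS](trmxK x) -trmx_mul [RHS]mxE. Qed.

Lemma dotvDl x1 x2 z : dotv (x1 + x2) z = dotv x1 z + dotv x2 z.
Proof. by rewrite /dotv linearD mulmxDl mxE. Qed.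

Lemma dotvZl (a : R) x z : dotv (a *: x) z = a * dotv x z.
Proof. by rewrite /dotv linearZ -scalemxAl mxE. Qed.

Lemma l2norm_ge0 x : 0 <= l2norm x.
Proof. exact: sqrtr_ge0. Qed.

Lemma sqr_l2norm x : l2norm x ^+ 2 = dotv x x.
Proof.
rewrite /l2norm sqr_sqrtr; last by apply: sumr_ge0 => i _; exact: sqr_ge0.
by rewrite /dotv mxE; apply: eq_bigr => i _; rewrite mxE expr2.
Qed.

Lemma sqr_l2normD x z :
  l2norm (x + z) ^+ 2 = l2norm x ^+ 2 + 2 * dotv x z + l2norm z ^+ 2.
Proof.
rewrite !sqr_l2norm dotvDl !(dotvC _ (x + z)) !dotvDl (dotvC z x).
by ring.
Qed.

Lemma l2normZ (a : R) x : l2norm (a *: x) = `|a| * l2norm x.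
Proof.
apply/eqP; rewrite -(@eqrXn2 _ 2)// ?mulr_ge0 ?l2norm_ge0//.
rewrite exprMn !sqr_l2norm dotvZl dotvC dotvZl mulrA -expr2.
by rewrite real_normK ?num_real.
Qed.

Lemma l2norm0 : l2norm (0 : 'cV[R]_d) = 0.
Proof. by rewrite -(scale0r 0) l2normZ normr0 mul0r. Qed.

Lemma l2normN x : l2norm (- x) = l2norm x.
Proof. by rewrite -scaleN1r l2normZ normrN1 mul1r. Qed.

Lemma l2norm_eq0 x : l2norm x = 0 -> x = 0.
Proof.
move=> /(congr1 (fun r => r ^+ 2)); rewrite sqr_l2norm expr0n /= /dotv mxE.
move=> /eqP; rewrite psumr_eq0 => [/allP x0|i _]; last first.
  by rewrite mxE -expr2 sqr_ge0.
apply/colP => i; have := x0 i (mem_index_enum i).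
by rewrite mxE mulf_eq0 orbb mxE => /eqP.
Qed.

Lemma coord_le_l2norm x i : `|x i 0| <= l2norm x.
Proof.
rewrite -(@ler_pXn2r _ 2)// ?nnegrE ?l2norm_ge0//.
rewrite real_normK ?num_real// sqr_l2norm /dotv mxE.
rewrite (bigD1 i)//= mxE -expr2 lerDl sumr_ge0// => j _.
by rewrite mxE -expr2 sqr_ge0.
Qed.

End EuclideanNorm.

Section SpectralNorm.
Variables (R : realType) (p d : nat) (A : 'M[R]_(p, d)).

Lemma dotv_trmx (r : 'cV[R]_p) (x : 'cV[R]_d) :
  dotv (A^T *m r) x = dotv r (A *m x).
Proof. by rewrite /dotv trmx_mul trmxK mulmxA. Qed.

(** The supremum defining [specnorm] is over a bounded set: on the unit ball
    every coordinate is at most 1 in absolute value, which bounds each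
    coordinate of the image by an absolute row sum. *)
Lemma specnorm_ubound (x : 'cV[R]_d) :
  l2norm x <= 1 -> l2norm (A *m x) <= specnorm A.
Proof.
move=> x1; apply: ub_le_sup; last by exists x.
exists (Num.sqrt (\sum_(i < p) (\sum_(j < d) `|A i j|) ^+ 2)) => _ [z /= z1 <-].
rewrite ler_wsqrtr// ler_sum// => i _.
rewrite -[leLHS]real_normK ?num_real// ler_pXn2r// ?nnegrE ?sumr_ge0//.
rewrite mxE (le_trans (ler_norm_sum _ _ _))// ler_sum// => j _.
by rewrite normrM ler_piMr// (le_trans (coord_le_l2norm _ _)).
Qed.

Lemma specnorm_ge0 : 0 <= specnorm A.
Proof.
by rewrite (le_trans _ (@specnorm_ubound 0 _)) ?l2norm_ge0// l2norm0 ler01.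
Qed.

Lemma l2norm_mulmx (x : 'cV[R]_d) :
  l2norm (A *m x) <= specnorm A * l2norm x.
Proof.
have [/l2norm_eq0 ->|x0] := eqVneq (l2norm x) 0.
  by rewrite mulmx0 !l2norm0 mulr0.
have x_gt0 : 0 < l2norm x by rewrite lt_def x0 l2norm_ge0.
have := @specnorm_ubound ((l2norm x)^-1 *: x).
rewrite -scalemxAr !l2normZ ger0_norm ?invr_ge0 ?l2norm_ge0//.
by rewrite mulVf// lexx mulrC ler_pdivrMr//; exact.
Qed.

End SpectralNorm.

(** * Distances to sets *)

Section Distance.
Variables (R : realType) (d : nat).
Implicit Types (x z : 'cV[R]_d) (A B : set 'cV[R]_d).

Lemma dist_le x z A : A z -> dist x A <= l2norm (x - z).
Proof.
move=> Az; apply: ge_inf; last by exists z.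
by exists 0 => _ [w _ <-]; exact: l2norm_ge0.
Qed.

Lemma le_dist x A (r : R) : A !=set0 ->
  (forall z, A z -> r <= l2norm (x - z)) -> r <= dist x A.
Proof.
move=> [z Az] rA; apply: lb_le_inf; first by exists (l2norm (x - z)), z.
by move=> _ [w Aw <-]; exact: rA.
Qed.

Lemma set_dist_le_dist x A B : A x -> B !=set0 -> set_dist A B <= dist x B.
Proof.
move=> Ax B0; apply: le_dist => // z Bz; apply: ge_inf; last by exists x, z.
by exists 0 => _ [z1 [z2 [_ _ ->]]]; exact: l2norm_ge0.
Qed.

End Distance.

(** * Faces of the complementarity set *)

Section Faces.
Variables (R : realType) (n : nat).
Implicit Types (y : 'cV[R]_(n + n)) (s : {ffun 'I_n -> int}).

(** The mirror image of [face_sign]: a degenerate coordinate is assigned to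
    the other block.  On the complementarity set both sign vectors select faces
    through [y], and they agree exactly when [y] has no degenerate
    coordinate. *)
Definition co_face_sign y : {ffun 'I_n -> int} :=
  [ffun i => if (0 < vpart y i) || ((upart y i == 0) && (vpart y i == 0))
             then -1 else 1].

Lemma mem_face_of y : compl_set y -> face_of y y.
Proof.
move=> Cy; split=> // i; rewrite ffunE; have [u0 v0 uv] := Cy i.
case: ltgtP u0 => //= [u_gt0 _|u0 _].
  by split=> // _; move/eqP: uv; rewrite mulf_eq0 gt_eqF//= => /eqP.
by split=> //; case: eqVneq.
Qed.

Lemma mem_co_face y : compl_set y -> face (co_face_sign y) y.
Proof.
move=> Cy; split=> // i; rewrite ffunE; have [u0 v0 uv] := Cy i.
case: ltgtP v0 => //= [v_gt0 _|v0 _].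
  by split=> // _; move/eqP: uv; rewrite mulf_eq0 (gt_eqF v_gt0) orbF => /eqP.
by rewrite andbT; split=> //; case: eqVneq.
Qed.

Lemma faces_face_of y : @faces R n (face_of y).
Proof. by exists (face_sign y) => // i; rewrite ffunE; case: ifP; auto. Qed.

Lemma faces_co_face y : @faces R n (face (co_face_sign y)).
Proof. by exists (co_face_sign y) => // i; rewrite ffunE; case: ifP; auto. Qed.

(** The unit vector of the i-th u-coordinate lies in every face that leaves
    that coordinate free, and in no face that forces it to vanish. *)
Lemma face_sub_sign s s' i :
  face (R := R) s `<=` face s' -> s i = 1 -> s' i <> -1.
Proof.
move=> ss' si s'i; pose e : 'cV[R]_(n + n) := col_mx (delta_mx i 0) 0.
have ue j : upart e j = (j == i)%:R.
  by rewrite /upart col_mxKu mxE eqxx andbT.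
have ve j : vpart e j = 0 by rewrite /vpart col_mxKd mxE.
have [|_ /(_ i)[_ /(_ s'i)/eqP]] := ss' e; last by rewrite ue eqxx oner_eq0.
split=> j; rewrite ue ve; first by rewrite mulr0 ler0n.
by split=> // sj; case: eqVneq => // ji; move: sj; rewrite ji si.
Qed.

Lemma face_inj s s' : (forall i, s i = 1 \/ s i = -1) ->
  (forall i, s' i = 1 \/ s' i = -1) -> face (R := R) s = face s' -> s = s'.
Proof.
move=> sP s'P ss'; apply/ffunP => i.
case: (sP i) (s'P i) => [] si [] s'i; rewrite si s'i //.
  by have := @face_sub_sign s s' i _ si s'i; rewrite ss'; case.
by have := @face_sub_sign s' s i _ s'i si; rewrite ss'; case.
Qed.

Lemma activity_nondegenerate y :
  compl_set y -> face_sign y = co_face_sign y -> activity y = face_sign y.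
Proof.
move=> Cy /ffunP yy; apply/ffunP => i; have := yy i.
rewrite !ffunE; have [u0 v0 uv] := Cy i.
move: uv => /eqP; rewrite mulf_eq0.
case: ltgtP u0 => //= [u_gt0 _ /eqP ->|<- _ _].
  by rewrite subr0 gtr0_sgz.
case: ltgtP v0 => //= v_gt0 _ _.
by rewrite sub0r sgzN gtr0_sgz.
Qed.

End Faces.

(** * One projected-gradient step *)

Section Step.
Variables (R : realType) (m n : nat).
Variables (P Q : 'M[R]_(m, n)) (c : 'cV[R]_m).
Implicit Types y z : 'cV[R]_(n + n).

Local Notation H := (Hmx P Q).
Local Notation L := (Lconst P Q).
Local Notation Phi := (Phi P Q c).
Local Notation resid := (resid P Q c).
Local Notation sols := (sols P Q c).

Lemma resid_ge0 y : 0 <= resid y.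
Proof. exact: l2norm_ge0. Qed.

Lemma Phi_ge0 y : 0 <= Phi y.
Proof. by rewrite mulr_ge0// sqr_ge0. Qed.

Lemma residE y : Num.sqrt (2 * Phi y) = resid y.
Proof. by rewrite mulrA divff// mul1r sqrtr_sqr ger0_norm ?resid_ge0. Qed.

Lemma Phi_sol y : sols y -> Phi y = 0.
Proof.
case=> _ yc.
by rewrite /Defs.Phi /Defs.resid yc subrr l2norm0 expr0n mulr0.
Qed.

(** For a solution [z], the residual vector of [y] is the image of [y - z]. *)
Lemma resid_le_dist y : sols !=set0 -> resid y <= specnorm H * dist y sols.
Proof.
move=> sols0.
have le_sol z : sols z -> resid y <= specnorm H * l2norm (y - z).
  by move=> [_ zc]; rewrite /Defs.resid -zc -mulmxBr l2norm_mulmx.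
have [H0|H_neq0] := eqVneq (specnorm H) 0.
  by have [z /le_sol] := sols0; rewrite H0 !mul0r.
have H_gt0 : 0 < specnorm H by rewrite lt_def H_neq0 specnorm_ge0.
rewrite mulrC -ler_pdivrMr//; apply: le_dist => // z /le_sol.
by rewrite ler_pdivrMr// mulrC.
Qed.

(** Since [y] itself competes in the projection, the step [z - y] makes an
    obtuse angle with the gradient, quantified by its own length; the rest is
    the exact second-order expansion of the quadratic [Phi].  On a nonconvex
    set this comparison replaces the variational inequality of a projection, at
    the price of the factor 1/2 in front of the inverse stepsize. *)
Lemma pg_descent (a : R) y z : 0 < a -> compl_set y -> pg_proj P Q c a y z ->
  Phi z <= Phi y - (1 / (2 * a) - L / 2) * l2norm (z - y) ^+ 2.
Proof.
move=> a_gt0 Cy [_ /(_ y Cy)]; set g := gradPhi P Q c y; set d := z - y.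
have -> : y - a *: g - z = - (d + a *: g).
  by rewrite opprD opprB addrAC.
have -> : y - a *: g - y = - (a *: g) by rewrite addrAC subrr add0r.
rewrite !l2normN -ler_sqr ?nnegrE ?l2norm_ge0// sqr_l2normD gerDr => angle.
rewrite dotvC dotvZl in angle.
have rz : resid z ^+ 2 = resid y ^+ 2 + 2 * dotv g d + l2norm (H *m d) ^+ 2.
  rewrite /g /gradPhi dotv_trmx -sqr_l2normD /Defs.resid.
  by congr (l2norm _ ^+ 2); rewrite mulmxBr [RHS]addrC addrA subrK.
have Hd : l2norm (H *m d) ^+ 2 <= L * l2norm d ^+ 2.
  rewrite -exprMn ler_sqr ?nnegrE ?mulr_ge0 ?l2norm_ge0 ?specnorm_ge0//.
  exact: l2norm_mulmx.
have gd : dotv g d <= - (1 / (2 * a) * l2norm d ^+ 2).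
  rewrite -(@ler_pM2l _ (2 * a)) ?mulr_gt0// mulrN !mulrA mulr1 divff ?mul1r.
    by move: angle; rewrite mulrA; lra.
  by rewrite mulf_neq0// gt_eqF.
by rewrite /Defs.Phi rz; lra.
Qed.

Lemma pg_resid_le (a : R) y z : 0 < a -> pg_proj P Q c a y z ->
  pg_resid P Q c a y <= a^-1 * l2norm (z - y).
Proof.
move=> a_gt0 yz; have := @dist_le _ _ 0 (a^-1 *: (y - z)) (pg_map P Q c a y).
rewrite sub0r l2normN l2normZ gtr0_norm ?invr_gt0// -l2normN opprB; apply.
by exists z.
Qed.

(** The error bound forces the step to be at least a fixed multiple of
    [dist y sols], and [Phi y] is at most [L / 2] times the square of that
    distance; hence the decrease granted by [pg_descent] is a fixed fraction of
    [Phi y] itself. *)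
Lemma pg_contraction (a alo ahi kappa : R) y z :
    0 < L -> sols !=set0 -> 0 < alo -> alo <= a <= ahi -> ahi < 1 / L ->
    0 < kappa -> dist y sols <= kappa * pg_resid P Q c a y ->
    compl_set y -> pg_proj P Q c a y z ->
  Phi z <= (1 - 2 * (1 / (2 * ahi) - L / 2) * alo ^+ 2 / (L * kappa ^+ 2))
           * Phi y.
Proof.
move=> L_gt0 sols0 alo_gt0 /andP[alo_a a_ahi] ahi_L kappa_gt0 err Cy yz.
have a_gt0 : 0 < a := lt_le_trans alo_gt0 alo_a.
have ahi_gt0 : 0 < ahi := lt_le_trans a_gt0 a_ahi.
apply: le_trans (pg_descent a_gt0 Cy yz) _.
set t := l2norm (z - y); set cd := 1 / (2 * ahi) - L / 2.
have cd_le : cd <= 1 / (2 * a) - L / 2.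
  by rewrite lerD2r !div1r lef_pV2 ?posrE ?mulr_gt0// ler_pM2l.
have cd_ge0 : 0 <= cd.
  rewrite subr_ge0 ler_pdivlMr ?mulr_gt0// mulrA divfK//.
  by rewrite mulrC -ler_pdivlMr// ltW.
have dist_step : resid y <= specnorm H * (kappa * (alo^-1 * t)).
  rewrite (le_trans (resid_le_dist y sols0))// ler_wpM2l ?specnorm_ge0//.
  rewrite (le_trans err)// ler_pM2l// (le_trans (pg_resid_le a_gt0 yz))//.
  by rewrite ler_wpM2r ?l2norm_ge0// lef_pV2.
have resid_step : resid y ^+ 2 <= L * kappa ^+ 2 / alo ^+ 2 * t ^+ 2.
  have -> : L * kappa ^+ 2 / alo ^+ 2 * t ^+ 2
            = (specnorm H * (kappa * (alo^-1 * t))) ^+ 2.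
    by rewrite !exprMn exprVn !mulrA.
  by rewrite ler_sqr ?nnegrE ?(le_trans (resid_ge0 y) dist_step) ?resid_ge0.
have fraction :
    2 * cd * alo ^+ 2 / (L * kappa ^+ 2) * Phi y <= cd * t ^+ 2.
  have -> : 2 * cd * alo ^+ 2 / (L * kappa ^+ 2) * Phi y
            = cd * (resid y ^+ 2 / (L * kappa ^+ 2 / alo ^+ 2)).
    by rewrite /Defs.Phi; field; rewrite ?gt_eqF.
  rewrite ler_wpM2l// ler_pdivrMr; first by rewrite mulrC.
  by apply: divr_gt0; [apply: mulr_gt0 => //|]; exact: exprn_gt0.
rewrite [leRHS]mulrBl [1 * Phi y]mul1r lerB// (le_trans fraction)//.
by rewrite ler_wpM2r ?sqr_ge0.
Qed.

Lemma resid_decay (th : R) K y z : 0 <= th -> Phi z <= th ^+ K * Phi y ->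
  resid z <= resid y * th `^ (K%:R / 2).
Proof.
move=> th_ge0; rewrite /Defs.Phi [leRHS]mulrCA ler_pM2l ?invr_gt0// => zy.
rewrite -ler_sqr ?nnegrE ?mulr_ge0 ?resid_ge0 ?powR_ge0//.
rewrite exprMn -[X in _ * X]powR_mulrn ?powR_ge0// -powRrM divfK//.
by rewrite powR_mulrn// mulrC.
Qed.

End Step.

(** * Identification of a solution face *)

Section Identification.
Variables (R : realType) (m n : nat).
Variables (P Q : 'M[R]_(m, n)) (c : 'cV[R]_m).
Implicit Types z w : 'cV[R]_(n + n).

Local Notation sols := (sols P Q c).
Local Notation near_sols z := ((dist z sols)%:E < gammaS P Q c)%E.

(** [gammaS] bounds from below the distance between [sols] and the faces that
    miss it, and a face through [z] is no farther from [sols] than [z]. *)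
Lemma sol_faces_near F z : sols !=set0 -> faces F -> F z -> near_sols z ->
  sol_faces P Q c F.
Proof.
move=> sols0 FF Fz; have [//|Fsol] := pselect (sol_faces P Q c F).
rewrite ltNge => /negP[]; apply: (@le_trans _ _ (set_dist F sols)%:E).
  by apply: ereal_inf_lbound; exists F.
by rewrite lee_fin set_dist_le_dist.
Qed.

(** Near the solution set every face through the point meets [sols], hence is
    the only such face.  A degenerate coordinate would put the point on two
    distinct faces, so there is none, and the activity vector is the sign
    vector of the only face. *)
Lemma activity_near z w : sols !=set0 ->
    (exists F, sol_faces P Q c = [set F]) ->
    compl_set z -> near_sols z -> compl_set w -> near_sols w ->
  activity z = activity w.
Proof.
move=> sols0 [F unique] Cz z_near Cw w_near.
have onlyF G x : near_sols x -> faces G -> G x -> G = F.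
  by move=> xn Gf Gx; have := sol_faces_near sols0 Gf Gx xn; rewrite unique.
have sgnP x i : face_sign x i = 1 \/ face_sign x i = -1.
  by rewrite ffunE; case: ifP; auto.
have co_sgnP x i : co_face_sign x i = 1 \/ co_face_sign x i = -1.
  by rewrite ffunE; case: ifP; auto.
have faceF x : compl_set x -> near_sols x -> face_of x = F.
  by move=> Cx xn; apply: (onlyF _ _ xn (faces_face_of x)); exact: mem_face_of.
have co_faceF x : compl_set x -> near_sols x -> face (co_face_sign x) = F.
  by move=> Cx xn; apply: (onlyF _ _ xn (faces_co_face x)); exact: mem_co_face.
have act x : compl_set x -> near_sols x -> activity x = face_sign x.
  move=> Cx xn; apply: activity_nondegenerate => //.
  apply: (@face_inj R) => //; rewrite co_faceF//; exact: faceF.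
rewrite !act//; apply: (@face_inj R) => //.
by rewrite -!/(face_of _) !faceF.
Qed.

End Identification.

(** * The safeguarded iteration *)

Section Run.
Variables (R : realType) (m n : nat).
Variables (P Q : 'M[R]_(m, n)) (c : 'cV[R]_m).
Variables (q : nat) (tau : R) (alpha : nat -> R).
Variables (y ybar : nat -> 'cV[R]_(n + n)).
Variables (yhat : nat -> option 'cV[R]_(n + n)) (nu : nat -> nat).
Hypothesis run : safeguarded_pg P Q c q tau alpha y ybar yhat nu.

Local Notation Phi := (Phi P Q c).

Lemma spg_compl k : compl_set (y k).
Proof.
case: k => [|k]; first exact: spg_init run.
have [Cbar _] := spg_proj run k.
by rewrite (spg_next run); case: (yhat _) => // z; case: asboolP => // -[].
Qed.

Lemma spg_safeguard k : Phi (y k.+1) <= Phi (ybar k.+1).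
Proof.
by rewrite (spg_next run); case: (yhat _) => // z; case: asboolP => // -[].
Qed.

(** A solution passes the safeguard because it minimizes [Phi]. *)
Lemma spg_accept k z : trigger P Q c q tau ybar nu k -> yhat k.+1 = Some z ->
  sols P Q c z -> y k.+1 = z.
Proof.
move=> Tk yz Sz; rewrite (spg_next run) yz; case: asboolP => // -[].
by split=> //; [case: Sz | rewrite (Phi_sol Sz) Phi_ge0].
Qed.

(** Contraction is only available on the level set, so membership of the
    iterates in it has to be carried along by the induction. *)
Lemma spg_decay (th : R) : 0 <= th <= 1 ->
    (forall k, level_set P Q c (y 0) (y k) ->
       Phi (ybar k.+1) <= th * Phi (y k)) ->
  forall k, Phi (y k) <= th ^+ k * Phi (y 0) /\
            Phi (ybar k.+1) <= th ^+ k.+1 * Phi (y 0).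
Proof.
move=> /andP[th0 th1] contr.
have step k : Phi (y k) <= th ^+ k * Phi (y 0) ->
    Phi (ybar k.+1) <= th ^+ k.+1 * Phi (y 0).
  move=> yk; rewrite exprS -mulrA (le_trans (contr k _)) ?ler_wpM2l//.
  split; first exact: spg_compl.
  by rewrite (le_trans yk)// ler_piMl ?Phi_ge0// exprn_ile1.
have main k : Phi (y k) <= th ^+ k * Phi (y 0).
  elim: k => [|k IH]; first by rewrite expr0 mul1r.
  by rewrite (le_trans (spg_safeguard k)) ?step.
by move=> k; split=> //; exact: step.
Qed.

Lemma spg_counter K :
    (forall k, (K <= k)%N -> activity (ybar k.+1) = activity (y k)) ->
  forall j, (j <= nu (K + j))%N.
Proof.
move=> stable; elim=> // j IH.
by rewrite addnS (spg_nu run) stable ?leq_addr// eqxx ltnS.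
Qed.

End Run.

(** * Iteration counts of a geometric sequence *)

(** The maximum with 1 makes the logarithm nonnegative, so that the ceiling is
    a natural number and can compete with the least index; it also covers the
    case where the bound holds from the start. *)
Lemma least_geometric_le (R : realType) (r tau th : R) (K : nat) :
    0 < tau -> 0 < th < 1 ->
    is_least [set K | r * th `^ (K%:R / 2) <= tau] K ->
  K%:Z <= Num.ceil (2 * ln (Num.max 1 (r / tau)) / ln (1 / th)).
Proof.
move=> tau_gt0 /andP[th_gt0 th_lt1] [_ K_least].
set x := Num.max 1 (r / tau); set b := (X in Num.ceil X).
have x_ge1 : 1 <= x by rewrite le_max lexx.
have x_gt0 : 0 < x := lt_le_trans ltr01 x_ge1.
have ln_th : 0 < ln (1 / th) by rewrite ln_gt0// div1r invf_gt1.
have b_ge0 : 0 <= b.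
  by apply: divr_ge0; [apply: mulr_ge0 => //; exact: ln_ge0 | exact: ltW].
have ceil_ge0 : 0 <= Num.ceil b.
  by rewrite -(ler_int R) (le_trans b_ge0)// ceil_ge.
rewrite -(gez0_abs ceil_ge0) lez_nat; apply: K_least => /=.
set N := `|Num.ceil b|%N.
have bN : b <= N%:R by rewrite natr_absz ger0_norm// ceil_ge.
have th_x : th `^ (N%:R / 2) <= x^-1.
  rewrite -[leRHS]lnK ?posrE ?invr_gt0// /powR gt_eqF// ler_expR lnV ?posrE//.
  move: bN ln_th; rewrite div1r lnV ?posrE// /b div1r lnV ?posrE// => bN lth.
  by move: bN; rewrite ler_pdivrMr//; lra.
have r_x : r / tau <= x by rewrite le_max lexx orbT.
rewrite -[leRHS]mul1r -ler_pdivrMr// mulrAC.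
apply: le_trans (ler_wpM2r (powR_ge0 _ _) r_x) _.
by rewrite -ler_pdivlMl// mulr1.
Qed.

(** * Reaching the solution set *)

Theorem corollary6 (R : realType) (m n : nat) (P Q : 'M[R]_(m, n))
    (c : 'cV[R]_m) (q : nat) (tau : R) (alpha : nat -> R)
    (y ybar : nat -> 'cV[R]_(n + n)) (yhat : nat -> option 'cV[R]_(n + n))
    (nu : nat -> nat) (alo ahi : R) (A : set R)
    (kappa_r kappa_G cd eta theta C0 : R) (Kid : nat)
    (L_gt0 : 0 < Lconst P Q)
    (q_ge1 : (1 <= q)%N)
    (tau_ge0 : 0 <= tau)
    (run : safeguarded_pg P Q c q tau alpha y ybar yhat nu)
    (alo_gt0 : 0 < alo)
    (alpha_bnd : forall k, alo <= alpha k <= ahi)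
    (ahi_lt : ahi < 1 / Lconst P Q)
    (sols_neq0 : sols P Q c !=set0)
    (level_bnd : exists M : R,
       forall z, level_set P Q c (y 0%N) z -> l2norm z <= M)
    (stationary_sols :
       \bigcup_(a in [set a : R | 0 < a])
          [set z | compl_set z /\ pg_proj P Q c a z z] `<=` sols P Q c)
    (A_fin : finite_set A)
    (A_neq0 : A !=set0)
    (A_sub : A `<=` [set a | alo <= a <= ahi])
    (alpha_A : forall k, A (alpha k))
    (kappa_r_gt0 : 0 < kappa_r)
    (kappa_rP : forall z, level_set P Q c (y 0%N) z ->
       dist z (sols P Q c) <= kappa_r * resid P Q c z)
    (kappa_G_gt0 : 0 < kappa_G)
    (kappa_GP : forall z a, level_set P Q c (y 0%N) z -> A a ->
       dist z (sols P Q c) <= kappa_G * pg_resid P Q c a z)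
    (cdE : cd = 1 / (2 * ahi) - Lconst P Q / 2)
    (etaE : eta = 2 * cd * alo ^+ 2 / (Lconst P Q * kappa_G ^+ 2))
    (eta01 : 0 < eta < 1)
    (thetaE : theta = 1 - eta)
    (C0E : C0 = kappa_r * Num.sqrt (2 * Phi P Q c (y 0%N)))
    (KidP : if (gammaS P Q c < +oo)%E
            then is_least
              [set K | ((C0 * theta `^ (K%:R / 2))%:E < gammaS P Q c)%E] Kid
            else Kid = 0%N)
    (refine_sol : forall k, trigger P Q c q tau ybar nu k ->
       sol_faces P Q c (face_of (ybar k.+1)) ->
       exists2 z, yhat k.+1 = Some z & sols P Q c z) :
  (0 < tau -> forall Ktau : nat,
     is_least [set K | Num.sqrt (2 * Phi P Q c (y 0%N)) / res_scale c
                       * theta `^ (K%:R / 2) <= tau] Ktau ->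
     (exists2 k, (k <= maxn Kid Ktau + 1)%N & sols P Q c (y k)) /\
     (Ktau%:Z <= Num.ceil
        (2 * ln (Num.max 1 (Num.sqrt (2 * Phi P Q c (y 0%N))
                            / (res_scale c * tau)))
         / ln (1 / theta))))
  /\
  ((exists F, sol_faces P Q c = [set F]) ->
     exists2 k, (k <= Kid + q)%N & sols P Q c (y k)).
Proof.
have theta_in01 : 0 < theta < 1 by move: eta01; rewrite thetaE; lra.
have theta01 : 0 <= theta <= 1 by case/andP: theta_in01 => /ltW -> /ltW ->.
have theta_ge0 : 0 <= theta by case/andP: theta01.
have theta_le1 : theta <= 1 by case/andP: theta01.
have decay := spg_decay run theta01.
have {}decay k : Phi P Q c (y k) <= theta ^+ k * Phi P Q c (y 0%N) /\
    Phi P Q c (ybar k.+1) <= theta ^+ k.+1 * Phi P Q c (y 0%N).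
  apply: decay => {}k lev; have [Cyk _] := lev; rewrite thetaE etaE cdE.
  apply: (pg_contraction L_gt0 sols_neq0 alo_gt0 (alpha_bnd k) ahi_lt
            kappa_G_gt0 _ Cyk (spg_proj run k)).
  exact: kappa_GP.
have in_level K z : compl_set z ->
    Phi P Q c z <= theta ^+ K * Phi P Q c (y 0%N) -> level_set P Q c (y 0%N) z.
  move=> Cz /le_trans zK; split=> //; apply: zK.
  by rewrite ler_piMl ?Phi_ge0// exprn_ile1.
have powR_mono K j : (K <= j)%N -> theta `^ (j%:R / 2) <= theta `^ (K%:R / 2).
  move=> Kj; apply: ger_powR; first by case/andP: theta_in01 => -> _.
  by rewrite ler_pM2r// ler_nat.
have near K z : (Kid <= K)%N -> compl_set z ->
    Phi P Q c z <= theta ^+ K * Phi P Q c (y 0%N) ->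
    ((dist z (sols P Q c))%:E < gammaS P Q c)%E.
  move=> KidK Cz zK; case: ifPn KidP => [_ [Kid_near _]|]; last first.
    by rewrite -leNgt => gamma_oo _; exact: lt_le_trans (ltry _) gamma_oo.
  apply: le_lt_trans Kid_near; rewrite lee_fin.
  rewrite (le_trans (kappa_rP _ (in_level K z Cz zK)))// C0E residE -mulrA.
  rewrite ler_pM2l// (le_trans (resid_decay theta_ge0 zK))//.
  by rewrite ler_wpM2l ?resid_ge0// powR_mono.
have Cbar k : compl_set (ybar k.+1) by case: (spg_proj run k).
have bar_near k : (Kid <= k.+1)%N ->
    ((dist (ybar k.+1) (sols P Q c))%:E < gammaS P Q c)%E.
  by move=> Kk; apply: near Kk (Cbar k) _; case: (decay k).
have reach k : (Kid <= k.+1)%N -> trigger P Q c q tau ybar nu k ->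
    sols P Q c (y k.+1).
  move=> Kk Tk; have [|z yz Sz] := refine_sol k Tk.
    exact: sol_faces_near sols_neq0 (faces_face_of _) (mem_face_of (Cbar k))
             (bar_near k Kk).
  by rewrite (spg_accept run Tk yz Sz).
have s_gt0 : 0 < res_scale c by rewrite lt_max ltr01.
split=> [tau_gt0 Ktau KtauP|unique].
  split; last first.
    by rewrite invfM mulrA; exact: least_geometric_le.
  have [Ktau_le _] := KtauP.
  (* Solutions appear among the y with one more index than the iteration that
     fires the trigger, hence the final + 1 in the bound. *)
  exists (maxn Kid Ktau).+1; first by rewrite addn1.
  apply: reach; first by rewrite leqW// leq_maxl.
  left; apply: le_trans Ktau_le; rewrite residE mulrAC ler_pM2r ?invr_gt0//.
  have [_ /(resid_decay theta_ge0) bar_le] := decay (maxn Kid Ktau).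
  rewrite (le_trans bar_le)// ler_wpM2l ?resid_ge0// powR_mono//.
  by rewrite leqW// leq_maxr.
have stable k : (Kid <= k)%N -> activity (ybar k.+1) = activity (y k).
  move=> Kk; apply: (activity_near sols_neq0 unique) => //.
  - by apply: bar_near; rewrite leqW.
  - exact: (spg_compl run).
  - by apply: (near k) => //; [exact: (spg_compl run) | case: (decay k)].
have := spg_counter run stable q.
(* The counter with index Kid + q is the one tested at iteration
   Kid + q - 1, which produces y (Kid + q). *)
case: q q_ge1 reach {refine_sol run} => // q' _ reach nu_q.
exists (Kid + q'.+1)%N => //; rewrite addnS; apply: reach.
  by rewrite leqW// leq_addr.
by right; rewrite -addnS.
Qed.
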